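(* Let $\lambda$ be a regular uncountable cardinal such that $\square^*_\lambda$ holds. Then for every stationary $S\subseteq E^{\lambda^+}_\lambda$ there exists a transversal $\vec C=\langle C_\delta\mid\delta<\lambda^+\rangle$ for $\square^*_\lambda$ such that for every club $D\subseteq\lambda^+$ there is $\delta\in S$ with $\sup(\mathrm{nacc}(C_\delta)\cap D\cap E^{\lambda^+}_\lambda)=\delta$.
   Context: For a set of ordinals $A$: $\mathrm{acc}(A)=\{\alpha\in A\mid\sup(A\cap\alpha)=\alpha>0\}$, $\mathrm{nacc}(A)=A\setminus\mathrm{acc}(A)$. $E^{\lambda^+}_\lambda=\{\alpha<\lambda^+\mid\mathrm{cf}(\alpha)=\lambda\}$. A $C$-sequence over $\lambda^+$ is $\langle C_\delta\mid\delta<\lambda^+\rangle$ with each $C_\delta$ a closed subset of $\delta$ with $\sup(C_\delta)=\sup(\delta)$. It is weakly coherent if for every $\alpha<\lambda^+$, $|\{C_\delta\cap\alpha\mid\delta<\lambda^+\}|<\lambda^+$. A transversal for $\square^*_\lambda$ is a weakly coherent $C$-sequence $\langle C_\delta\mid\delta<\lambda^+\rangle$ with $\mathrm{otp}(C_\delta)\le\lambda$ for all $\delta$. $\square^*_\lambda$ (weak square) asserts the existence of $\langle\mathcal C_\alpha\mid\alpha<\lambda^+\rangle$ such that for every limit $\alpha$, $1\le|\mathcal C_\alpha|\le\lambda$ and each $C\in\mathcal C_\alpha$ is club in $\alpha$ of order type $\le\lambda$, and for every $C\in\mathcal C_\alpha$ and $\bar\alpha\in\mathrm{acc}(C)$,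 $C\cap\bar\alpha\in\mathcal C_{\bar\alpha}$ (equivalently, a transversal for $\square^*_\lambda$ exists). *)

(* Defs.v *)
From mathcomp Require Import all_boot all_order.
From mathcomp Require Import boolp classical_sets functions cardinality wochoice.

Set Implicit Arguments.
Unset Strict Implicit.
Unset Printing Implicit Defensive.

Import Order.TTheory.

Local Open Scope order_scope.
Local Open Scope classical_set_scope.
Local Open Scope card_scope.

(* Throughout, [K] is a well-ordered type playing the role of lambda^+ (see
   [succ_cardinal]): its elements are the ordinals below lambda^+, and an
   ordinal [a : K] is identified, in von Neumann style, with the set [below a]
   of its predecessors. The cardinal lambda is itself an element of [K].
   An equation "sup(A) = s" is rendered as [supremums A s], "[s] is the least
   upper bound of [A]"; thus sup(0) = 0 and sup(b + 1) = b. *)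

Definition card_lt T U (A : set T) (B : set U) : Prop :=
  A #<= B /\ ~ (B #<= A).

Section Ordinals.
Context {d : Order.disp_t} {K : orderType d}.
Implicit Types (a b k lam : K) (A C D S : set K).

Definition below a : set K := [set x | x < a].

Definition otp_is A b : Prop :=
  exists f : K -> K,
    set_bij A (below b) f /\ (forall x y, A x -> A y -> x < y -> f x < f y).

Definition otp_le A lam : Prop := exists2 b, otp_is A b & b <= lam.

Definition cofinal_in a A : Prop :=
  A `<=` below a /\ (forall x, x < a -> exists2 y, A y & x <= y).

Definition cf_is a k : Prop :=
  (exists2 A, cofinal_in a A & otp_is A k) /\
  (forall A b, cofinal_in a A -> otp_is A b -> k <= b).

(* E^{lambda^+}_lambda *)
Definition Ecf lam : set K := [set a | cf_is a lam].

Definition is_cardinal lam : Prop :=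
  forall b, b < lam -> card_lt (below b) (below lam).

Definition regular_uncountable lam : Prop :=
  [/\ is_cardinal lam, cf_is lam lam & ~ countable (below lam)].

(* All a with sup(A cap a) = a > 0; such an a need not belong to A. *)
Definition limit_points A : set K :=
  [set a | (exists b, b < a) /\ supremums (A `&` below a) a].

Definition acc A : set K := A `&` limit_points A.
Definition nacc A : set K := A `\` acc A.

Definition limit_ordinal a : Prop := limit_points setT a.

Definition closed_in a C : Prop :=
  C `<=` below a /\ below a `&` limit_points C `<=` C.

Definition club_in a C : Prop := closed_in a C /\ supremums C a.

(* Club and stationary subsets of lambda^+, i.e. of the whole of [K]. *)
Definition club D : Prop :=
  limit_points D `<=` D /\ (forall a, exists2 b, D b & a <= b).

Definition stationary S : Prop := forall D, club D -> S `&` D !=set0.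

(* Both sets of suprema below are singletons, as [C a] and [below a] are bounded
   by [a]; so their equality says sup(C_a) = sup(a). *)
Definition C_sequence (C : K -> set K) : Prop :=
  forall a, closed_in a (C a) /\ supremums (C a) = supremums (below a).

Definition weakly_coherent (C : K -> set K) : Prop :=
  forall a, card_lt [set C b `&` below a | b in [set: K]] [set: K].

Definition square_transversal lam (C : K -> set K) : Prop :=
  [/\ C_sequence C, weakly_coherent C & forall a, otp_le (C a) lam].

Definition weak_square lam : Prop :=
  exists CC : K -> set (set K),
    forall a, limit_ordinal a ->
      [/\ CC a !=set0, CC a #<= below lam &
          forall C, CC a C ->
            [/\ club_in a C, otp_le C lam &
                forall b, acc C b -> CC b (C `&` below b)]].

End Ordinals.

(* [K] has order type lambda^+: it is a well-order of cardinality greater than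
   lambda all of whose proper initial segments have cardinality at most
   lambda. *)
Definition succ_cardinal (d : Order.disp_t) (K : orderType d) (lam : K) : Prop :=
  [/\ well_order (<=%O : rel K),
      forall a : K, below a #<= below lam &
      ~ ([set: K] #<= below lam)].

(* Main.v *)
(* Fix a transversal C. For a club D, the D-walk from a towards x in D, x < a,
   goes down from a to the largest point of D below min (C_a \ x), and is
   repeated until it reaches x or a point of cofinality lambda. Let F_D(a) be the
   set of the x in D that are reached by the D-walk from a. Then F_D(a) is closed
   in a, its proper initial segments have size < lambda, and F_D(a) cap b is
   coded by a finite sequence of sets C_g cap b, so that F_D inherits weak
   coherence. Points of cofinality lambda in F_D(a) are never accumulation points
   of F_D(a), because fewer than lambda points are below them.

   If every D were refuted by some club E(D), put D_(n+1) = D_n cap E(D_n), with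
   intersection D_w, and pick a in S that is a limit of points x in D_w of
   cofinality lambda. The n-th walk from a towards x passes through ordinals that
   decrease with n, hence stabilize; so for n large it stops at a point of
   D_w of cofinality lambda in [x, a) that is in F_(D_n)(a). As cf(a) > omega, one
   n works for cofinally many x, against the choice of E(D_n). *)

Require Import Defs.
From mathcomp Require Import all_boot all_order.
From mathcomp Require Import boolp classical_sets functions cardinality wochoice.

Set Implicit Arguments.
Unset Strict Implicit.
Unset Printing Implicit Defensive.

Import Order.TTheory.

Local Open Scope order_scope.
Local Open Scope classical_set_scope.
Local Open Scope card_scope.

(** * Cardinal comparison through functions and relations *)

Lemma card_le_fun T U (u0 : U) (A : set T) (B : set U) : A #<= B ->
  exists f : T -> U,
    (forall x, A x -> B (f x)) /\ (forall x y, A x -> A y -> f x = f y -> x = y).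
Proof.
elim/Ppointed: U => U in u0 B *; first by case: (no u0).
move=> /pcard_leP[f].
exists f; split=> [x Ax|x y Ax Ay]; first exact: funS.
by apply: (@inj _ _ _ f) => //; exact/mem_set.
Qed.

(** Choice turns [R] into a function, which the second hypothesis makes injective on [A]; [R] itself
    need not be functional. *)
Lemma card_le_rel T U (A : set T) (B : set U) (R : T -> U -> Prop) :
    (forall x, A x -> exists2 y, B y & R x y) ->
    (forall x x' y, A x -> A x' -> R x y -> R x' y -> x = x') ->
  A #<= B.
Proof.
move=> exR injR; have [[u0 _]|noU] := pselect (exists u : U, True); last first.
  suff -> : A = set0 by exact: card_ge0.
  by apply/seteqP; split=> // x /exR[y]; case: noU; exists y.
have /choice[f fP] (x : T) : exists y, A x -> B y /\ R x y.
  by have [/exR[y By Rxy]|nAx] := pselect (A x); [exists y|exists u0].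
have -> : A = [set x | A x] by [].
have <- : (f @` A #<= B) = (A #<= B).
  apply: card_le_eql; apply: inj_card_eq => x y /set_mem Ax /set_mem Ay fxy.
  apply: (injR _ _ (f x)) => //; first by case: (fP x Ax).
  by rewrite fxy; case: (fP y Ay).
by apply: subset_card_le => _ [x Ax <-]; case: (fP x Ax).
Qed.

(** Stands for |X| < lambda. The negated form passes to subsets and images without comparability of
    cardinals. *)
Definition small {d : Order.disp_t} {K : orderType d} (lam : K) T (X : set T) :=
  ~ (below lam #<= X).

(* [lam] is the junk value, taken when [A] is empty. *)
Definition minimum {d : Order.disp_t} {K : orderType d} (lam : K) (A : set K) : K :=
  xget lam [set m | A m /\ forall x, A x -> m <= x].

(** * Order types *)

Section WellOrder.
Context {d : Order.disp_t} {K : orderType d} (lam : K).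
Context (wo : well_order (<=%O : rel K)).
Implicit Types (a b : K) (A C D : set K).

Lemma set_minimum A : A !=set0 -> exists m, A m /\ forall x, A x -> m <= x.
Proof.
move=> [a Aa]; have [|m [[Am mP] _]] := wo (A := [pred x | `[< A x >]]).
  by exists a; exact/asboolP.
exists m; split; first exact/asboolP.
by move=> x Ax; apply: mP; exact/asboolP.
Qed.

Lemma minimumP A : A !=set0 ->
  A (minimum lam A) /\ forall x, A x -> minimum lam A <= x.
Proof. by move=> /set_minimum exm; apply: (xgetPex lam exm). Qed.

Lemma lt_wf : well_founded (fun x y : K => x < y).
Proof.
move=> a; apply: contrapT => na.
have [|m [nm mP]] := @set_minimum [set x | ~ Acc (fun x y : K => x < y) x].
  by exists a.
apply: nm; constructor => y ym; apply: contrapT => /mP.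
by rewrite leNgt ym.
Qed.

Lemma lt_ind (P : K -> Prop) :
  (forall x, (forall y, y < x -> P y) -> P x) -> forall x, P x.
Proof. by move=> h x; elim/(well_founded_ind lt_wf): x. Qed.

(** Mostowski collapse by well-founded recursion: [x] goes to the least ordinal below [lam] that is
    not the value of a predecessor in [X]. Such an ordinal exists because the predecessors form a
    small set. A general [R] allows pairs to be collapsed as well as subsets of [K]. *)
Lemma collapse T (X : set T) (R : T -> T -> Prop) :
    well_founded R -> (forall x y z, R x y -> R y z -> R x z) ->
    (forall x y, X x -> X y -> [\/ x = y, R x y | R y x]) ->
    (forall x, X x -> small lam (X `&` [set y | R y x])) ->
  exists b (f : T -> K), [/\ b <= lam, set_bij X (below b) f &
    forall x y, X x -> X y -> R x y -> f x < f y].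
Proof.
move=> wfR trR totR smR.
pose F x (rec : forall y, R y x -> K) :=
  minimum lam [set v | v < lam /\ forall y (h : R y x), X y -> rec y h <> v].
pose f := Fix wfR (fun _ => K) F.
have fE x : f x = minimum lam [set v | v < lam /\ forall y, R y x -> X y -> f y <> v].
  rewrite /f Fix_eq //= => {}x g h gh; congr (F x _).
  by apply: functional_extensionality_dep => y; apply: functional_extensionality_dep => p.
have fP x : X x -> [/\ f x < lam, forall y, R y x -> X y -> f y <> f x &
    forall v, v < f x -> exists y, [/\ R y x, X y & f y = v]].
  move=> Xx; set V := [set v | v < lam /\ forall y, R y x -> X y -> f y <> v].
  have [|[flam fne] fmin] := @minimumP V.
    apply: contrapT => V0; apply: (smR _ Xx).
    apply: card_le_trans (card_image_le f _); apply: subset_card_le => v vlam.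
    apply: contrapT => nv; apply: V0; exists v; split=> // y Ryx Xy fyv.
    by apply: nv; exists y.
  rewrite fE -/V; split=> // v vlt; apply: contrapT => nv.
  have : V v by split=> [|y Ryx Xy fyv]; [exact: lt_trans flam|apply: nv; exists y].
  by move/fmin; rewrite leNgt vlt.
have fR x y : X x -> X y -> R x y -> f x < f y.
  move=> Xx Xy Rxy; have [_ fney _] := fP _ Xy; have [_ _ fx] := fP _ Xx.
  have [//|fyx|fxy] := ltgtP (f x) (f y); last by case: (fney x).
  have [z [Rzx Xz fz]] := fx _ fyx.
  by case: (fney z) => //; exact: trR Rxy.
have finj x y : X x -> X y -> f x = f y -> x = y.
  move=> Xx Xy fxy; case: (totR _ _ Xx Xy) => // h.
    by move: (fR _ _ Xx Xy h); rewrite fxy ltxx.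
  by move: (fR _ _ Xy Xx h); rewrite fxy ltxx.
(* [lam] is never a value, so the least ordinal that is not a value is at most [lam]. *)
have [b [b1 b2]] : exists b, b <= lam /\ f @` X = below b.
  pose V := [set v | v <= lam /\ ~ (f @` X) v].
  have [|[blam bX] bmin] := @minimumP V.
    by exists lam; split=> // -[x Xx fx]; have [] := fP _ Xx; rewrite fx ltxx.
  exists (minimum lam V); split=> //; apply/seteqP; split=> [_ [x Xx <-]|v vb].
    rewrite /below /= ltNge; apply/negP; rewrite le_eqVlt => /orP[/eqP e|bx].
      by apply: bX; rewrite e; exists x.
    have [_ _ /(_ _ bx)[y [Ryx Xy fy]]] := fP _ Xx.
    by apply: bX; rewrite -fy; exists y.
  apply: contrapT => nv; have : V v.
    by split=> //; apply: le_trans blam; exact: ltW.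
  by move/bmin; rewrite leNgt vb.
exists b, f; split=> //; split.
- by move=> x Xx; rewrite -b2; exists x.
- by move=> x y /set_mem Xx /set_mem Xy; exact: finj.
- by rewrite /set_surj b2.
Qed.

End WellOrder.

(** * Regularity of lambda *)

Section Regular.
Context {d : Order.disp_t} {K : orderType d} (lam : K).
Context (wo : well_order (<=%O : rel K)) (hlam : regular_uncountable lam).
Implicit Types (a b : K) (A C D : set K).

Lemma small_le T U (X : set T) (Y : set U) : X #<= Y -> small lam Y -> small lam X.
Proof. by move=> XY sY lX; apply: sY; exact: card_le_trans XY. Qed.

Lemma small_sub T (X Y : set T) : X `<=` Y -> small lam Y -> small lam X.
Proof. by move=> /subset_card_le; exact: small_le. Qed.

Lemma small_image T U (f : T -> U) (X : set T) : small lam X -> small lam (f @` X).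
Proof. exact: small_le (card_image_le _ _). Qed.

Lemma small_below b : b < lam -> small lam (below b).
Proof. by case: hlam => + _ _ => /[apply] -[]. Qed.

Lemma small_countable T (X : set T) : countable X -> small lam X.
Proof. by case: hlam => _ _ nc cX /card_le_trans/(_ cX). Qed.

(** The collapse of a small [A] has type at most [lam], and cofinality makes it at least [lam]; but
    a set of type [lam] is not small. *)
Lemma cf_small a A : Ecf lam a -> cofinal_in a A -> ~ small lam A.
Proof.
move=> [_ minlam] cA sA.
have [|||b [f [blam fbij fmon]]] := collapse wo (lt_wf wo) (X := A) (lam := lam).
- by move=> x y z; exact: lt_trans.
- by move=> x y _ _; case: (ltgtP x y) => h; [constructor 2|constructor 3|constructor 1].
- by move=> x _; apply: small_sub sA => y [].
have lb : lam <= b by apply: minlam cA _; exists f; split.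
have eb : b = lam by apply/eqP; rewrite eq_le blam lb.
apply: sA; rewrite -eb; apply: (@card_le_rel _ _ _ _ (fun x y => f y = x)).
  by move=> x xb; case: fbij => _ _ /(_ _ xb)[y Ay <-]; exists y.
by move=> x x' y _ _ -> .
Qed.

Lemma small_bounded A : A `<=` below lam -> small lam A ->
  exists2 b, b < lam & forall x, A x -> x < b.
Proof.
move=> Alam sA; apply: contrapT => nb; apply: (@cf_small lam A) => //.
  by case: hlam.
split=> // x xlam; apply: contrapT => nx; apply: nb; exists x => // y Ay.
by rewrite ltNge; apply/negP => xy; apply: nx; exists y.
Qed.

Lemma limit_lam a : a < lam -> exists2 b, b < lam & a < b.
Proof.
move=> alam; have [||b blam bP] := @small_bounded [set a].
- by move=> _ ->.
- by apply: small_countable; exact: countable1.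
- by exists b => //; exact: bP.
Qed.

(** Suppose [g] injects lambda into the union. By regularity the indices sent into a single [F i]
    are bounded by some [h i] below [lam], and all the [h i] by some [b] below [lam]. The index [b]
    itself is then sent nowhere. *)
Lemma small_bigcup I T (A : set I) (F : I -> set T) :
    small lam A -> (forall i, A i -> small lam (F i)) ->
  small lam (\bigcup_(i in A) F i).
Proof.
move=> sA sF; have [[t0 _]|noT] := pselect (exists t : T, True); last first.
  apply: small_countable; suff -> : \bigcup_(i in A) F i = set0 by exact: countable0.
  by apply/seteqP; split=> // t; case: noT; exists t.
move=> /(card_le_fun t0)[g [gU ginj]].
have /choice[h hP] i : exists b, A i ->
    b < lam /\ forall x, x < lam -> F i (g x) -> x < b.
  have [Ai|] := pselect (A i); last by exists lam.
  have [||b blam bP] := @small_bounded [set x | x < lam /\ F i (g x)].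
  - by move=> x [].
  - apply: small_le (sF _ Ai); apply: (@card_le_rel _ _ _ _ (fun x y => y = g x)).
      by move=> x [_ Fx]; exists (g x).
    by move=> x x' y [xlam _] [x'lam _] ->; exact: ginj.
  - by exists b => _; split=> // x xlam Fx; exact: bP.
have [||b blam bP] := @small_bounded (h @` A).
- by move=> _ [i Ai <-]; case: (hP i Ai).
- exact: small_image.
have [i Ai Fi] := gU _ blam; have [_ /(_ _ blam Fi)] := hP i Ai.
by apply/negP; rewrite -leNgt ltW //; apply: bP; exists i.
Qed.

Lemma small_setU T (X Y : set T) : small lam X -> small lam Y -> small lam (X `|` Y).
Proof.
move=> sX sY; rewrite -bigcup2E; apply: small_bigcup.
  exact: small_countable.
by move=> [|[|i]] _ //=; apply: small_countable; exact: countable0.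
Qed.

(* Goedel's well-order of pairs; its initial segments are small by regularity,
   so that lambda x lambda has size lambda without cardinal arithmetic. *)
Let pair_lt (p q : K * K) :=
  let m (r : K * K) := Order.max r.1 r.2 in
  m p < m q \/ (m p = m q /\ (p.1 < q.1 \/ (p.1 = q.1 /\ p.2 < q.2))).

Lemma pair_lt_wf : well_founded pair_lt.
Proof.
suff h : forall m a b, Order.max a b = m -> Acc pair_lt (a, b).
  by move=> [a b]; exact: h.
elim/(lt_ind wo) => m IHm; elim/(lt_ind wo) => a IHa; elim/(lt_ind wo) => b IHb.
move=> mE; constructor => -[a' b'] [/=|[/= e [l|[ea l]]]].
- by rewrite mE => /IHm; apply.
- by apply: (IHa _ l); rewrite e.
- by rewrite ea in e *; apply: IHb => //; rewrite e.
Qed.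

Lemma card_le_setX : below lam `*` below lam #<= below lam.
Proof.
have [|||b [f [blam [f1 f2 _] _]]] :=
    collapse wo pair_lt_wf (X := below lam `*` below lam) (lam := lam).
- move=> [a b] [a' b'] [a'' b'']; rewrite /pair_lt /=.
  move=> [l|[-> l]] [l'|[<- l']]; try by left => //; exact: lt_trans l'.
  right; split=> //; case: l => [l|[-> l]]; case: l' => [l'|[<- l']].
  + by left; exact: lt_trans l'.
  + by left.
  + by left.
  + by right; split=> //; exact: lt_trans l'.
- move=> [a b] [a' b'] _ _; rewrite /pair_lt /=.
  case: (ltgtP (Order.max a b) (Order.max a' b')) => [l|l|e].
  + by constructor 2; left.
  + by constructor 3; left.
  + case: (ltgtP a a') => [l|l|ea].
    * by constructor 2; right; split=> //; left.
    * by constructor 3; right; split=> //; left.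
    * case: (ltgtP b b') => [l|l|eb].
      - by constructor 2; right; split=> //; right.
      - by constructor 3; right; split=> //; right.
      - by constructor 1; rewrite ea eb.
(* Predecessors of (a, b) have maximum at most max(a, b) < c, so they lie in c x c, a small union of
   small sets. *)
- move=> [a b] [/= alam blam]; have [|c clam mc] := @limit_lam (Order.max a b).
    by rewrite gt_max alam blam.
  have sc := small_below clam.
  apply: (@small_sub _ _ (\bigcup_(x in below c) (pair x @` below c))).
    move=> [a' b'] [_ R']; have : Order.max a' b' <= Order.max a b.
      by case: R' => [/ltW|[/= ->]].
    move=> /le_lt_trans/(_ mc); rewrite gt_max => /andP[a'c b'c].
    by exists a' => //; exists b'.
  by apply: small_bigcup => // x _; exact: small_image.
apply: (@card_le_rel _ _ _ _ (fun p y => f p = y)).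
  by move=> p Xp; exists (f p) => //; exact: lt_le_trans (f1 _ Xp) blam.
by move=> p q y Xp Xq <- fpq; apply: f2; rewrite ?inE.
Qed.

Lemma card_le_bigcup I T (A : set I) (F : I -> set T) :
    A #<= below lam -> (forall i, A i -> F i #<= below lam) ->
  \bigcup_(i in A) F i #<= below lam.
Proof.
move=> /(card_le_fun lam)[g [gA ginj]] Fle.
have /choice[h hP] i : exists h : T -> K, A i ->
    (forall x, F i x -> h x < lam) /\
    (forall x y, F i x -> F i y -> h x = h y -> x = y).
  have [/Fle/(card_le_fun lam)[h hP]|] := pselect (A i); first by exists h.
  by exists (fun=> lam).
apply: card_le_trans card_le_setX; apply: (@card_le_rel _ _ _ _
  (fun x p => exists i, [/\ A i, F i x & p = (g i, h i x)])).
  move=> x [i Ai Fix]; exists (g i, h i x); last by exists i.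
  by split; [exact: gA|case: (hP _ Ai) => + _; apply].
move=> x y _ _ _ [i [Ai Fx ->]] [j [Aj Fy [gij hij]]].
have e := ginj _ _ Ai Aj gij; rewrite -e in Fy hij.
by case: (hP _ Ai) => _; apply.
Qed.

Lemma card_le_countable T (X : set T) : countable X -> X #<= below lam.
Proof.
move=> /card_le_trans; apply; apply/infiniteP => fin.
by case: hlam => _ _; apply; exact: finite_set_countable.
Qed.

Lemma card_le_setU T (X Y : set T) :
  X #<= below lam -> Y #<= below lam -> X `|` Y #<= below lam.
Proof.
move=> sX sY; rewrite -bigcup2E; apply: card_le_bigcup.
  exact: card_le_countable.
by move=> [|[|i]] _ //=; exact: card_ge0.
Qed.

(** Elements are coded by a base element and a finite string of parameters from [A]. Both coherence
    arguments count initial segments by placing them in such a closure. *)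
Inductive op_closure I T (A : set I) (op : I -> T -> T) (B : set T) : T -> Prop :=
| op_closure_base t : B t -> op_closure A op B t
| op_closure_step i t : A i -> op_closure A op B t -> op_closure A op B (op i t).

Lemma card_le_op_closure I T (A : set I) (op : I -> T -> T) (B : set T) :
  A #<= below lam -> B #<= below lam -> op_closure A op B #<= below lam.
Proof.
move=> Ale Ble.
pose stage := fun n => iter n (fun X => \bigcup_(i in A) (op i @` X)) B.
apply: (@card_le_trans _ _ _ (\bigcup_n stage n)).
  apply: subset_card_le => t; elim=> [{}t Bt|i {}t Ai _ [n _ sn]]; first by exists 0%N.
  by exists n.+1 => //; exists i => //; exists t.
apply: card_le_bigcup => [|n _]; first exact: card_le_countable.
elim: n => [//|n IHn]; apply: card_le_bigcup => // i _.
exact: card_le_trans (card_image_le _ _) IHn.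
Qed.

End Regular.

(** * Limit points and clubs *)

Section Limits.
Context {d : Order.disp_t} {K : orderType d}.
Implicit Types (a b x y : K) (A C D X : set K).

Lemma limit_pointsP A a : limit_points A a <->
  (exists b, b < a) /\ forall x, x < a -> exists y, [/\ A y, x < y & y < a].
Proof.
split=> [[exb [_ lba]]|[exb h]]; split=> //; last first.
  split=> [y [_ /ltW] //|u ub]; rewrite leNgt; apply/negP => /h[y [Ay uy ya]].
  by have := ub _ (conj Ay ya); rewrite leNgt uy.
move=> x xa; apply: contrapT => ny; have /lba : ubound (A `&` below a) x.
  move=> y [Ay ya]; rewrite leNgt; apply/negP => xy; apply: ny.
  by exists y.
by rewrite leNgt xa.
Qed.

Lemma limit_points_sub A B a : A `<=` B -> limit_points A a -> limit_points B a.
Proof.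
move=> AB /limit_pointsP[exb h]; apply/limit_pointsP; split=> // x /h[y [/AB]].
by exists y.
Qed.

Lemma supremumsP X a : X `<=` below a ->
  supremums X a <-> forall x, x < a -> exists2 y, X y & x < y.
Proof.
move=> Xa; split=> [[_ lba] x xa|h].
  apply: contrapT => ny; have /lba : ubound X x.
    by move=> y Xy; rewrite leNgt; apply/negP => xy; apply: ny; exists y.
  by rewrite leNgt xa.
split=> [y /Xa /ltW //|u ub]; rewrite leNgt; apply/negP => /h[y Xy].
by rewrite ltNge ub.
Qed.

Lemma cofinal_supremums X a : cofinal_in a X -> supremums X = supremums (below a).
Proof.
move=> [Xa h]; suff e : ubound X = ubound (below a) by rewrite /supremums e.
apply/seteqP; split=> u ub y.
  by move=> /h[z /ub zu yz]; exact: le_trans zu.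
by move=> /Xa; exact: ub.
Qed.

End Limits.

(** * Bounded sets and clubs in lambda^+ *)

Section Successor.
Context {d : Order.disp_t} {K : orderType d} (lam : K).
Context (hK : succ_cardinal lam) (hlam : regular_uncountable lam).
Implicit Types (a b x y : K) (A C D X : set K).

Let wo : well_order (<=%O : rel K). Proof. by case: hK. Qed.

Lemma card_below_le a : below a #<= below lam.
Proof. by case: hK. Qed.

Lemma card_ge_le a : [set x | x <= a] #<= below lam.
Proof.
apply: (@card_le_trans _ _ _ (below a `|` [set a])).
  by apply: subset_card_le => x /=; rewrite le_eqVlt => /orP[/eqP->|]; [right|left].
apply: card_le_setU => //; first exact: card_below_le.
by apply: card_le_countable => //; exact: countable1.
Qed.

(** Regularity of lambda^+: an unbounded [X] of size at most lambda would cover [K] by lambda many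
    initial segments of size at most lambda. *)
Lemma card_le_bounded X : X #<= below lam -> exists b, forall x, X x -> x < b.
Proof.
move=> Xle; apply: contrapT => nb; case: hK => _ _; apply.
apply: (@card_le_trans _ _ _ (\bigcup_(x in X) [set y | y <= x])).
  apply: subset_card_le => y _; apply: contrapT => ny; apply: nb; exists y.
  by move=> x Xx; rewrite ltNge; apply/negP => yx; apply: ny; exists x.
by apply: card_le_bigcup => // x _; exact: card_ge_le.
Qed.

Lemma exists_gt a : exists b, a < b.
Proof.
have [|b bP] := @card_le_bounded [set a]; last by exists b; exact: bP.
by apply: card_le_countable => //; exact: countable1.
Qed.

Definition unbounded A := forall a, exists2 b, A b & a < b.

Lemma club_unbounded D : club D -> unbounded D.
Proof.
move=> [_ Dge] a; have [b ab] := exists_gt a; have [c Dc bc] := Dge b.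
by exists c => //; exact: lt_le_trans bc.
Qed.

(** Iterate omega times a function that jumps past a point of every [U n]; the supremum of the
    iterates is a limit of all the [U n] at once. Clubs of limit points and countable intersections
    of clubs both come from this. *)
Lemma common_limit_point (U : nat -> set K) : (forall n, unbounded (U n)) ->
  forall a, exists2 s, a < s & forall n, limit_points (U n) s.
Proof.
move=> Uunb a; have /choice[nx nxP] x :
    exists y, forall n, exists2 u, U n u & x < u < y.
  have /choice[v vP] n : exists u, U n u /\ x < u.
    by have [u] := Uunb n x; exists u.
  have [|y yP] := @card_le_bounded (range v).
    apply: card_le_countable => //; apply: card_le_trans (card_image_le _ _) _.
    exact: card_lexx.
  exists y => n; exists (v n); have [Uv xv] := vP n => //.
  by rewrite xv /=; apply: yP; exists n.
pose s_ k := iter k nx a.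
have [|b0 b0P] := @card_le_bounded (range s_).
  apply: card_le_countable => //; apply: card_le_trans (card_image_le _ _) _.
  exact: card_lexx.
(* The iterates increase strictly, so their least strict upper bound is their supremum. *)
have [|sub smin] := @minimumP _ _ lam wo [set b | forall k, s_ k < b].
  by exists b0 => k; apply: b0P; exists k.
set s := minimum _ _ in sub smin; have as_ : a < s := sub 0%N.
exists s => // n; apply/limit_pointsP; split=> [|x xs]; first by exists a.
have [k xk] : exists k, x <= s_ k.
  apply: contrapT => nk; have : [set b | forall k, s_ k < b] x.
    by move=> k; rewrite ltNge; apply/negP => xk; apply: nk; exists k.
  by move/smin; rewrite leNgt xs.
have [u Uu /andP[su us]] := nxP (s_ k) n.
exists u; split=> //; first exact: le_lt_trans su.
exact: lt_trans us (sub k.+1).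
Qed.

Lemma club_limit_points A : unbounded A -> club (limit_points A).
Proof.
move=> Aunb; split=> [a /limit_pointsP[exb h]|a].
  apply/limit_pointsP; split=> // x /h[y [/limit_pointsP[_ h'] xy ya]].
  have [z [Az xz zy]] := h' _ xy.
  by exists z; split=> //; exact: lt_trans ya.
have [s /ltW] := @common_limit_point (fun=> A) (fun=> Aunb) a.
by move=> as_ /(_ 0%N); exists s.
Qed.

Lemma club_bigcap (D : nat -> set K) : (forall n, club (D n)) ->
  club (\bigcap_n D n).
Proof.
move=> Dclub; split=> [a lim n _|a].
  case: (Dclub n) => + _; apply; apply: limit_points_sub lim => x; exact.
have [s /ltW as_ sP] := @common_limit_point D (fun n => club_unbounded (Dclub n)) a.
by exists s => // n _; case: (Dclub n) => + _; apply.
Qed.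

Lemma clubI D D' : club D -> club D' -> club (D `&` D').
Proof.
move=> cD cD'; have -> : D `&` D' = \bigcap_n (if n == 0%N then D else D').
  apply/seteqP; split=> [x [Dx D'x] n _|x h]; first by case: ifP.
  by split; [exact: (h 0%N)|exact: (h 1%N)].
by apply: club_bigcap => n; case: ifP.
Qed.

Lemma club_setT : club [set: K].
Proof. by split=> // a; exists a. Qed.

Lemma stationary_unbounded S D : stationary S -> club D -> unbounded (S `&` D).
Proof.
move=> hS cD a; have : club [set x | a < x].
  split=> [x /limit_pointsP[[b /[dup] bx _] h]|b].
    have [y [/= ay _ yx]] := h _ bx; exact: lt_trans yx.
  have [c abc] := exists_gt (Order.max a b).
  by exists c; move: abc; rewrite gt_max => /andP[] // ? /ltW.
by move=> /(clubI cD)/hS[x [Sx [Dx ax]]]; exists x.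
Qed.

Definition floor D x := minimum lam (ubound (D `&` [set y | y <= x])).

Lemma floorP D x y : limit_points D `<=` D -> D y -> y <= x ->
  [/\ D (floor D x), y <= floor D x & floor D x <= x].
Proof.
move=> Dcl Dy yx; have xub : ubound (D `&` [set y | y <= x]) x by move=> z [].
have [|sub smin] := @minimumP _ _ lam wo (ubound (D `&` [set y | y <= x])).
  by exists x.
rewrite /floor; set s := minimum _ _ in sub smin *.
have ys : y <= s by exact: sub.
have sx : s <= x by exact: smin.
(* A supremum outside [D] is not attained, hence is a limit point of [D], and [D] contains its limit
   points. *)
split=> //; apply: contrapT => nDs; apply: (nDs); apply: Dcl.
apply/limit_pointsP; split=> [|z zs].
  exists y; rewrite lt_neqAle ys andbT; apply/eqP => e; by rewrite -e in nDs.
apply: contrapT => nz; have /smin : ubound (D `&` [set y | y <= x]) z.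
  move=> w [Dw wx]; rewrite leNgt; apply/negP => zw; apply: nz; exists w.
  split=> //; rewrite lt_neqAle sub // andbT; apply/eqP => e; by rewrite e in Dw.
by rewrite leNgt zs.
Qed.

(** * Order types at most lambda and their initial segments *)

Lemma otp_le_segments X : (forall x, X x -> small lam (X `&` below x)) ->
  otp_le X lam.
Proof.
move=> sX; have [|||b [f [blam fbij fmon]]] :=
    collapse wo (lt_wf wo) (X := X) (lam := lam).
- by move=> x y z; exact: lt_trans.
- by move=> x y _ _; case: (ltgtP x y) => h; [constructor 2|constructor 3|constructor 1].
- by move=> x Xx; exact: sX.
- by exists b => //; exists f.
Qed.

Lemma otp_card_le X b : otp_is X b -> X #<= below b.
Proof.
move=> [f [[f1 f2 _] _]]; apply: (@card_le_rel _ _ _ _ (fun x y => y = f x)).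
  by move=> x Xx; exists (f x) => //; exact: f1.
by move=> x y _ Xx Xy -> e; apply: f2; rewrite ?inE.
Qed.

Lemma small_segments X x : otp_le X lam -> X x -> small lam (X `&` below x).
Proof.
move=> [b [f [[f1 f2 _] fmon]] blam] Xx.
apply: (@small_le _ _ _ _ _ _ (below (f x))).
  apply: (@card_le_rel _ _ _ _ (fun x y => y = f x)).
    by move=> y [Xy yx]; exists (f y) => //; exact: fmon.
  by move=> y z _ [Xy _] [Xz _] -> e; apply: f2; rewrite ?inE.
apply: small_below => //; exact: lt_le_trans (f1 _ Xx) blam.
Qed.

(** If [X] is not small, its type is exactly lambda. A cofinal subset of [a] of smaller type, pushed
    up into [X], would then give a small cofinal subset of lambda; so [a] would have cofinality
    lambda. *)
Lemma small_cofinal a X : cofinal_in a X -> otp_le X lam -> ~ Ecf lam a ->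
  small lam X.
Proof.
move=> cX [b Xb blam] nE lX; apply: nE.
move: blam; rewrite le_eqVlt => /orP[/eqP eb|blam]; last first.
  by case: (small_below hlam blam); apply: card_le_trans lX (otp_card_le Xb).
rewrite eb in Xb; split; first by exists X.
move=> A c [Aa cA] Ac; rewrite leNgt; apply/negP => clam.
have sA : small lam A by apply: small_le (otp_card_le Ac) (small_below hlam clam).
case: Xb => f [[f1 f2 f3] fmon]; case: cX => Xa cX.
pose g y := minimum lam (X `&` [set x | y <= x]).
have gP y : y < a -> X (g y) /\ y <= g y.
  move=> /cX[z Xz yz]; have [|[]] := @minimumP _ _ lam wo (X `&` [set x | y <= x]).
    by exists z.
  by [].
have [||e elam eP] := @small_bounded _ _ _ wo hlam ((f \o g) @` A).
- by move=> _ [y Ay <-]; apply: f1; case: (gP _ (Aa _ Ay)).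
- exact: small_image.
have [z Xz fz] := f3 _ elam; have [y Ay zy] := cA _ (Xa _ Xz).
have [Xg yg] := gP _ (Aa _ Ay).
have : f (g y) < e by apply: eP; exists y.
apply/negP; rewrite -leNgt -fz.
have := le_trans zy yg; rewrite le_eqVlt => /orP[/eqP<- //|h].
by apply/ltW/fmon.
Qed.

(* If C_b cap x has no maximum and s is its supremum, then C_b cap x is a member
   of CC_s; otherwise remove the maximum and go on below it. So C_b cap a is
   obtained from a member of some CC_s, s <= a, by adding finitely many points. *)
Lemma weak_square_sequence : weak_square lam ->
  exists C : K -> set K, forall a, [/\ cofinal_in a (C a), closed_in a (C a),
    otp_le (C a) lam & [set C b `&` below a | b in [set: K]] #<= below lam].
Proof.
move=> [CC CCP].
(* At non-limits this is the sequence itself: {b} at b + 1, and the empty set at 0. *)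
pose top a := [set x | x < a /\ forall y, y < a -> y <= x].
have /choice[C CP] a : exists X, (limit_ordinal a -> CC a X) /\
    (~ limit_ordinal a -> X = top a).
  have [la|nla] := pselect (limit_ordinal a); last by exists (top a).
  by have [[X CX] _ _] := CCP _ la; exists X.
have topP a : ~ limit_ordinal a -> forall x, C a x -> forall y, y < a -> y <= x.
  by move=> nla x; case: (CP a) => _ /(_ nla) -> [].
have cofC a : cofinal_in a (C a).
  have [la|nla] := pselect (limit_ordinal a).
    have [_ _ /(_ _ (proj1 (CP a) la))[[[Ca _] supC] _ _]] := CCP _ la.
    split=> // x xa; have [+ _] := supremumsP Ca.
    by move=> /(_ supC _ xa)[y Cy /ltW]; exists y.
  rewrite (proj2 (CP a) nla); split=> [x []//|x xa]; apply: contrapT => nx.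
  apply: nla; apply/limit_pointsP; split=> [|y ya]; first by exists x.
  apply: contrapT => ny; apply: nx.
  have yub z : z < a -> z <= y.
    by move=> za; rewrite leNgt; apply/negP => yz; apply: ny; exists z.
  by exists y => //; exact: yub.
have closC a : closed_in a (C a).
  have [la|nla] := pselect (limit_ordinal a).
    by have [_ _ /(_ _ (proj1 (CP a) la))[[clC _] _ _]] := CCP _ la.
  split=> [|x [xa /limit_pointsP[[b bx] h]]]; first by case: (cofC a).
  have [y [Cy by_ yx]] := h _ bx; have [z [Cz yz zx]] := h _ yx.
  have := topP _ nla _ Cy z (lt_trans zx xa); by rewrite leNgt yz.
exists C => a; split=> //.
  have [la|nla] := pselect (limit_ordinal a).
    by have [_ _ /(_ _ (proj1 (CP a) la))[_ oC _]] := CCP _ la.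
  apply: otp_le_segments => x Cx; apply: small_countable => //.
  suff -> : C a `&` below x = set0 by exact: countable0.
  apply/seteqP; split=> // y [Cy yx]; have := topP _ nla _ Cy x.
  by rewrite leNgt yx => h; have : false by apply: h; case: (cofC a) => + _; apply.
pose B := [set set0] `|` \bigcup_(s in [set s | s <= a /\ limit_ordinal s]) CC s.
pose op m (t : set K) := t `|` [set m].
suff h b x : x <= a -> op_closure (below a) op B (C b `&` below x).
  apply: card_le_trans (card_le_op_closure wo hlam op (card_below_le a) (B := B) _).
    by apply: subset_card_le => _ [b _ <-]; exact: h.
  apply: card_le_setU => //.
    by apply: card_le_countable => //; exact: countable1.
  apply: card_le_bigcup => // [|s [_ ls]]; last by case: (CCP _ ls).
  by apply: card_le_trans (card_ge_le a); apply: subset_card_le => s [].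
elim/(lt_ind wo): x => x IH xa; set X := C b `&` below x.
have [X0|/eqP/set0P[x0 Xx0]] := pselect (X = set0).
  by rewrite X0; apply: op_closure_base; left.
have [[m [[Cm mx] mmax]]|nmax] := pselect (exists m, X m /\ forall y, X y -> y <= m).
  have -> : X = op m (C b `&` below m).
    apply/seteqP; split=> [y Xy|y [[Cy ym]|->]] //.
      have := mmax _ Xy; rewrite le_eqVlt => /orP[/eqP ->|ym]; first by right.
      by left; case: Xy.
    by split=> //; exact: lt_trans mx.
  apply: op_closure_step; first exact: lt_le_trans xa.
  by apply: IH => //; apply/ltW; exact: lt_le_trans xa.
have {}nmax y : X y -> exists2 z, X z & y < z.
  move=> Xy; apply: contrapT => nz; apply: nmax; exists y; split=> // z Xz.
  by rewrite leNgt; apply/negP => yz; apply: nz; exists z.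
have lb : limit_ordinal b.
  apply: contrapT => nlb; have [z [Cz zx] x0z] := nmax _ Xx0.
  have /(_ z) := topP _ nlb _ (proj1 Xx0).
  by rewrite leNgt x0z => h; have : false by apply: h; case: (cofC b) => + _; apply.
have [|sub smin] := @minimumP _ _ lam wo [set s | forall y, X y -> y < s].
  by exists x => y [].
set s := minimum _ _ in sub smin.
have sx : s <= x by apply: smin => y [].
have sb : s <= b by apply: smin => y [Cy _]; case: (cofC b) => + _; apply.
have Xs : X = C b `&` below s.
  apply/seteqP; split=> y [Cy yx]; split=> //; first exact: sub.
  exact: lt_le_trans sx.
have ls : limit_points (C b) s.
  apply/limit_pointsP; split=> [|y ys]; first by exists x0; exact: sub.
  have [z Xz yz] : exists2 z, X z & y <= z.
    apply: contrapT => nz; have : [set s | forall y, X y -> y < s] y.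
      by move=> z Xz; rewrite ltNge; apply/negP => yz; apply: nz; exists z.
    by move/smin; rewrite leNgt ys.
  have [w Xw zw] := nmax _ Xz.
  by exists w; split; [case: Xw|exact: le_lt_trans zw|exact: sub].
apply: op_closure_base; right; exists s.
  split; first exact: le_trans xa.
  by apply: limit_points_sub ls.
rewrite Xs; have CCb := proj1 (CP b) lb.
move: sb; rewrite le_eqVlt => /orP[/eqP->|sb].
  by rewrite setIidl //; case: (cofC b).
have [_ _ /(_ _ CCb)[_ _]] := CCP _ lb; apply; split=> //.
by case: (closC b) => _; apply.
Qed.

End Successor.

(** * Walks *)

Section Walks.
Context {d : Order.disp_t} {K : orderType d} (lam : K).
Context (hK : succ_cardinal lam) (hlam : regular_uncountable lam).
Context (C : K -> set K).
Context (hC : forall a, [/\ cofinal_in a (C a), closed_in a (C a),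
    otp_le (C a) lam & [set C b `&` below a | b in [set: K]] #<= below lam]).
Implicit Types (a b x y : K) (A D X : set K).

Let wo : well_order (<=%O : rel K). Proof. by case: hK. Qed.

Definition next a x := minimum lam (C a `&` [set y | x <= y]).

Lemma nextP a x : x < a -> [/\ C a (next a x), x <= next a x, next a x < a &
  forall y, C a y -> x <= y -> next a x <= y].
Proof.
move=> xa; have [[Ca cofC] _ _ _] := hC a; have [y Cy xy] := cofC _ xa.
have [|[Cn xn] nmin] := @minimumP _ _ lam wo (C a `&` [set y | x <= y]).
  by exists y.
by split=> //; [exact: Ca|move=> z Cz xz; exact: nmin].
Qed.

(** [C a] has no point in [x, next a x), so all targets in that interval, and its right end, share
    their first step from [a]. *)
Lemma next_eq a x y : x <= y -> y <= next a x -> x < a -> next a y = next a x.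
Proof.
move=> xy yn xa; have [Cn xn na nmin] := nextP xa.
have [Cn' yn' _ nmin'] := nextP (le_lt_trans yn na).
by apply/eqP; rewrite eq_le nmin' // nmin // (le_trans xy).
Qed.

Definition step D a x := floor lam D (next a x).

(** The target is the parameter and the start is the index. No constructor starts at a point of
    cofinality lambda other than [x]: this is how a walk stops there. *)
Inductive walk D x : K -> Prop :=
| walk_refl : walk D x x
| walk_step a : x < a -> ~ Ecf lam a -> walk D x (step D a x) -> walk D x a.

(** The first step leaves [a] whatever its cofinality, because the [a] of interest lie in S; only
    later points can stop the walk. *)
Definition fill D a : set K := [set x | [/\ D x, x < a & walk D x (step D a x)]].

Lemma walk_fill D x a : D x -> walk D x a -> a = x \/ (~ Ecf lam a /\ fill D a x).
Proof. by move=> Dx [|{}a xa nEa w]; [left|right]. Qed.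

Section Club.
Context (D : set K) (Dcl : limit_points D `<=` D).

Lemma stepP a x : D x -> x < a ->
  [/\ D (step D a x), x <= step D a x, step D a x <= next a x & step D a x < a].
Proof.
move=> Dx xa; have [_ xn na _] := nextP xa.
have [Df xf fn] := floorP hK Dcl Dx xn.
by split=> //; exact: le_lt_trans na.
Qed.

(** Let x be a limit of the fill. If the first step towards x does not land on x, then x is not in
    [C a], so [C a] is bounded below x by some z. Targets in (z, x) share the first step of x, so x
    is a limit of the fill of that smaller ordinal, and induction applies. *)
Lemma fill_closed a : closed_in a (fill D a).
Proof.
elim/(lt_ind wo): a => a IH; split=> [x []//|x [xa limx]].
have Dx : D x by apply: Dcl; apply: limit_points_sub limx => y [].
have [Dst xst stn sta] := stepP Dx xa; have [Cn xn na nmin] := nextP xa.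
split=> //; move: xst; rewrite le_eqVlt => /orP[/eqP <-|xst]; first exact: walk_refl.
have [z zx Cz] : exists2 z, z < x & forall y, C a y -> y < x -> y <= z.
  apply: contrapT => nz; have : C a x.
    have [_ [_ clC] _ _] := hC a; apply: clC; split=> //.
    case/limit_pointsP: limx => exb _; apply/limit_pointsP; split=> // z zx.
    apply: contrapT => ny; apply: nz; exists z => // y Cy yx.
    by rewrite leNgt; apply/negP => zy; apply: ny; exists y.
  by move=> /nmin/(_ (lexx _))/(le_trans stn); rewrite leNgt xst.
have fillP y : fill D a y -> z < y -> y < x ->
    ~ Ecf lam (step D a x) /\ fill D (step D a x) y.
  move=> [Dy ya wy] zy yx; have e : next a y = next a x.
    apply/esym/next_eq => //; first exact: ltW.
    have [Cy yn _ _] := nextP ya.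
    rewrite leNgt; apply/negP => /(Cz _ Cy)/(le_trans yn).
    by rewrite leNgt zy.
  move: wy; rewrite {1}/step e -/(step D a x) => /(walk_fill Dy)[] // e'.
  by move: (lt_trans yx xst); rewrite e' ltxx.
case/limit_pointsP: limx => exb limx.
have [y [Fy zy yx]] := limx _ zx; have [nE _] := fillP _ Fy zy yx.
apply: walk_step => //; suff : fill D (step D a x) x by case.
have [_] := IH _ sta; apply; split=> //; apply/limit_pointsP; split=> // w wx.
have [|v [Fv]] := limx (Order.max w z); first by rewrite gt_max wx zx.
rewrite gt_max => /andP[wv zv] vx; have [_ Fv'] := fillP _ Fv zv vx.
by exists v.
Qed.

(** Apart from the floor itself, such targets lie in the fill of the floor, and there are none if
    the floor has cofinality lambda. The hypothesis is bounded by [y] so that the lemma can serve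
    inside the induction of [small_fill]. *)
Lemma small_walk y : (forall b, b <= y -> ~ Ecf lam b -> small lam (fill D b)) ->
  small lam [set x | [/\ D x, x <= y & walk D x (floor lam D y)]].
Proof.
move=> IH; set X := [set x | _].
have [->|/eqP/set0P[x [Dx xy wx]]] := pselect (X = set0).
  by apply: small_countable => //; exact: countable0.
have [Df xf fy] := floorP hK Dcl Dx xy.
have [E|nE] := pselect (Ecf lam (floor lam D y)).
  apply: small_sub (small_countable hlam (countable1 (floor lam D y))).
  by move=> z [Dz zy /(walk_fill Dz)[->|[]]].
apply: small_sub (small_setU wo hlam
  (small_countable hlam (countable1 (floor lam D y))) (IH _ fy nE)).
by move=> z [Dz zy /(walk_fill Dz)[->|[]]]; [left|right].
Qed.

(** Sort the targets by the point of [C a] used in the first step: off cofinality lambda, [C a] is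
    small, and each class is small by induction. *)
Lemma small_fill a : ~ Ecf lam a -> small lam (fill D a).
Proof.
elim/(lt_ind wo): a => a IH nE; have [cofC _ oC _] := hC a.
have sC := small_cofinal hK hlam cofC oC nE.
apply: small_sub (small_bigcup wo hlam sC (F := fun y =>
  [set x | [/\ D x, x <= y & walk D x (floor lam D y)]]) _).
  move=> x [Dx xa wx]; have [Cn xn _ _] := nextP xa.
  by exists (next a x).
move=> y Cy; apply: small_walk => b yb nEb; apply: IH => //.
by apply: le_lt_trans yb _; case: cofC => + _; apply.
Qed.

(** Targets below [x] only use points of [C a] up to [next a x]. These are fewer than lambda even
    when [C a] has type lambda. *)
Lemma small_fill_segment a x : x < a -> small lam (fill D a `&` below x).
Proof.
move=> xa; have [cofC _ oC _] := hC a; have [Cn xn na nmin] := nextP xa.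
have sC : small lam (C a `&` below (next a x) `|` [set next a x]).
  apply: small_setU => //; first exact: small_segments.
  by apply: small_countable => //; exact: countable1.
apply: small_sub (small_bigcup wo hlam sC (F := fun y =>
  [set x | [/\ D x, x <= y & walk D x (floor lam D y)]]) _).
  move=> y [[Dy ya wy] yx]; have [Cy yn _ ymin] := nextP ya.
  exists (next a y) => //; have := ymin _ Cn (le_trans (ltW yx) xn).
  by rewrite le_eqVlt => /orP[/eqP->|]; [right|left].
by move=> y _; apply: small_walk => b _; exact: small_fill.
Qed.

Lemma fill_otp a : otp_le (fill D a) lam.
Proof.
by apply: otp_le_segments => // x [_ xa _]; exact: small_fill_segment.
Qed.

Lemma fill_nacc a x : fill D a x -> Ecf lam x -> nacc (fill D a) x.
Proof.
move=> Fx Ex; split=> // -[_ /limit_pointsP[_ h]].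
apply: (cf_small wo Ex (A := fill D a `&` below x)).
  split=> [y []//|y /h[z [Fz yz zx]]]; exists z => //; exact: ltW.
by apply: small_fill_segment; case: Fx.
Qed.

Lemma fill_coherent a : [set fill D b `&` below a | b in [set: K]] #<= below lam.
Proof.
(* For x < a, the first step from b towards x is decided by C_b cap a if this has
   a point above x; all other x share the first step y. *)
pose tail y := [set x | [/\ D x, x < a & walk D x y]].
pose op (c t : set K) := [set x | [/\ D x, x < a,
  (c `&` [set y | x <= y]) !=set0 ->
    walk D x (floor lam D (minimum lam (c `&` [set y | x <= y]))) &
  ~ ((c `&` [set y | x <= y]) !=set0) -> t x]].
pose B := [set set0] `|`
  ((fun b => fill D b `&` below a) @` [set b | b <= a] `|` tail @` [set b | b <= a]).
have [_ _ _ hCa] := hC a.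
suff h b : op_closure [set C b `&` below a | b in [set: K]] op B (fill D b `&` below a).
  apply: card_le_trans (card_le_op_closure wo hlam op hCa (B := B) _).
    by apply: subset_card_le => _ [b _ <-].
  apply: card_le_setU => //.
    by apply: card_le_countable => //; exact: countable1.
  by apply: card_le_setU => //;
    apply: card_le_trans (card_image_le _ _) _; exact: card_ge_le.
elim/(lt_ind wo): b => b IH; have [ba|ab] := leP b a.
  by apply: op_closure_base; right; left; exists b.
have [->|/eqP/set0P[z [[Dz zb _] za]]] := pselect (fill D b `&` below a = set0).
  by apply: op_closure_base; left.
have [Cn an nb nmin] := nextP ab.
have [Df zf fn] := floorP hK Dcl Dz (le_trans (ltW za) an).
set y := floor lam D (next b a) in Df zf fn.
have -> : fill D b `&` below a = op (C b `&` below a) (tail y).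
  suff E x : D x -> x < a -> walk D x (step D b x) <->
      ((C b `&` below a `&` [set y | x <= y]) !=set0 -> walk D x
        (floor lam D (minimum lam (C b `&` below a `&` [set y | x <= y])))) /\
      (~ ((C b `&` below a `&` [set y | x <= y]) !=set0) -> tail y x).
    apply/seteqP; split=> x.
      by move=> [[Dx xb wx] xa]; case/(E _ Dx xa): wx.
    move=> [Dx xa h1 h2]; split=> //; split=> //; first exact: lt_trans ab.
    exact/(E _ Dx xa).
  move=> Dx xa; have [Cx xn xb xmin] := nextP (lt_trans xa ab).
  have [ne|e] := pselect ((C b `&` below a `&` [set y | x <= y]) !=set0).
    have [[[Cm ma] xm] mmin] := minimumP lam wo ne.
    suff -> : minimum lam (C b `&` below a `&` [set y | x <= y]) = next b x.
      by split=> [w|[h1 _]]; [split|exact: h1].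
    apply/eqP; rewrite eq_le xmin // andbT; apply: mmin; split=> //; split=> //.
    by apply: le_lt_trans ma; exact: xmin.
  have e' : next b x = next b a.
    apply/esym/next_eq; [exact: ltW| |exact: lt_trans ab].
    by rewrite leNgt; apply/negP => na; apply: e; exists (next b x).
  rewrite /step e' -/y; split=> [w|[_ /(_ e)[]//]].
  by split.
apply: op_closure_step; first by exists b.
(* A shared first step y at or below [a] gives a base set. Above [a], either y has cofinality lambda
   and no target below [a] is reached, or the tail is the trace of the fill of y < b, covered by
   induction. *)
have [ya|ay] := leP y a; first by apply: op_closure_base; right; right; exists y.
have [Ey|nEy] := pselect (Ecf lam y).
  apply: op_closure_base; left; apply/seteqP; split=> // x [Dx xa].
  by move=> /(walk_fill Dx)[e|[]//]; move: (lt_trans xa ay); rewrite e ltxx.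
have -> : tail y = fill D y `&` below a.
  apply/seteqP; split=> x.
    move=> [Dx xa /(walk_fill Dx)[e|[]//]].
    by move: (lt_trans xa ay); rewrite e ltxx.
  by move=> [[Dx xy wx] xa]; split=> //; exact: walk_step.
by apply: IH; exact: le_lt_trans nb.
Qed.

End Club.

(** Falling back on [C a] keeps the supremum right where the fill is not cofinal, and at most adds
    the lambda many traces of [C] to be counted. *)
Definition fill_sequence D a : set K :=
  if `[< cofinal_in a (fill D a) >] then fill D a else C a.

Lemma fill_transversal D : club D -> square_transversal lam (fill_sequence D).
Proof.
move=> [Dcl _]; split=> a.
- have [cofC clC _ _] := hC a; rewrite /fill_sequence.
  by case: asboolP => cofF; split=> //; [exact: fill_closed| |]; exact: cofinal_supremums.
- have [_ _ _ coC] := hC a.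
  have h : [set fill_sequence D b `&` below a | b in [set: K]] #<= below lam.
    apply: card_le_trans (card_le_setU wo hlam coC (fill_coherent Dcl a)).
    apply: subset_card_le => _ [b _ <-]; rewrite /fill_sequence.
    by case: asboolP => _; [right|left]; exists b.
  split; first by apply: card_le_trans h (card_leT _).
  by move=> h'; case: hK => _ _; apply; exact: card_le_trans h' h.
- by rewrite /fill_sequence; case: asboolP => _; [exact: fill_otp|case: (hC a)].
Qed.

(** * Walks along a decreasing sequence of clubs *)

Section Decreasing.
Context (D : nat -> set K) (Dclub : forall n, club (D n)).
Context (Ddec : forall n, D n.+1 `<=` D n).

Lemma decreasing_sub m n : (m <= n)%N -> D n `<=` D m.
Proof.
elim: n => [|n IHn]; first by rewrite leqn0 => /eqP->.
rewrite leq_eqVlt => /orP[/eqP-> //|]; rewrite ltnS => /IHn h.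
by move=> x /Ddec/h.
Qed.

(** Floors can only decrease as the clubs shrink, so they stay constant once the least value is
    attained; [y] ensures that each floor lies in its club. *)
Lemma floor_stabilizes x y : (\bigcap_n D n) y -> y <= x -> exists N,
  forall n, (N <= n)%N -> floor lam (D n) x = floor lam (D N) x.
Proof.
move=> Dy yx.
have fP n := floorP hK (proj1 (Dclub n)) (Dy n I) yx.
have [|[N _ eN] mN] := @minimumP _ _ lam wo (range (fun n => floor lam (D n) x)).
  by exists (floor lam (D 0%N) x); exists 0%N.
exists N => n Nn; apply/eqP; rewrite eq_le eN mN ?andbT; last by exists n.
have [Dn _ nx] := fP n; rewrite -eN.
by have [] := floorP hK (proj1 (Dclub N)) (decreasing_sub Nn Dn) nx.
Qed.

(** The eventual first step y towards [b] lies in every [D n]. If it has cofinality lambda it is the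
    required point; otherwise it is above [b], and induction from y gives a point in [b, y), towards
    which the first step from [a] is again y. *)
Lemma fill_reach b a : (\bigcap_n D n) b -> Ecf lam b -> b < a ->
  exists y, [/\ (\bigcap_n D n) y, Ecf lam y, b <= y, y < a &
    exists N, forall n, (N <= n)%N -> fill (D n) a y].
Proof.
move=> Db Eb; elim/(lt_ind wo): a => a IH ba.
have [Cn bn na nmin] := nextP ba; have [N NP] := floor_stabilizes Db bn.
set y := floor lam (D N) (next a b) in NP.
have [DNy by_ yn] := floorP hK (proj1 (Dclub N)) (Db N I) bn.
rewrite -/y in DNy by_ yn.
have Dy : (\bigcap_n D n) y.
  move=> n _; have [Nn|/ltnW nN] := leqP N n; last exact: decreasing_sub DNy.
  rewrite -(NP _ Nn).
  by have [] := floorP hK (proj1 (Dclub n)) (Db n I) bn.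
have ya := le_lt_trans yn na.
have stepE z n : b <= z -> z <= y -> (N <= n)%N -> step (D n) a z = y.
  by move=> bz zy /NP <-; rewrite /step (next_eq bz (le_trans zy yn)).
have [Ey|nEy] := pselect (Ecf lam y).
  exists y; split=> //; exists N => n Nn; split=> //; first exact: Dy.
  by rewrite stepE //; exact: walk_refl.
have {}by_ : b < y.
  by rewrite lt_neqAle by_ andbT; apply/eqP => e; rewrite e in Eb.
have [z [Dz Ez bz zy [M MP]]] := IH _ ya by_.
exists z; split=> //; first exact: lt_trans ya.
exists (maxn N M) => n; rewrite geq_max => /andP[Nn /MP[Dnz _ wz]].
split=> //; first exact: lt_trans ya.
by rewrite stepE // ?ltW //; exact: walk_step.
Qed.

Lemma fill_guess S : stationary S -> S `<=` Ecf lam ->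
  exists n a, S a /\ supremums (nacc (fill_sequence (D n) a) `&` D n.+1 `&` Ecf lam) a.
Proof.
move=> hS SE.
have Dclubw := club_bigcap hK hlam Dclub.
(* Points of S in the intersection already have cofinality lambda, so these points are unbounded and
   S contains a limit of them. *)
have /(club_limit_points hK hlam)/hS[a [Sa /limit_pointsP[_ lima]]] :
    unbounded (\bigcap_n D n `&` Ecf lam).
  move=> x; have [y [Sy Dy] xy] := stationary_unbounded hK hlam hS Dclubw x.
  by exists y => //; split=> //; exact: SE.
(* If every n failed at some bound [f n] below [a], the countably many bounds would be cofinal in
   [a], against cf(a) = lambda > omega. *)
have [n nP] : exists n, forall x, x < a -> exists y,
    [/\ fill (D n) a y, (\bigcap_n D n) y, Ecf lam y & x < y].
  apply: contrapT => nn; have /choice[f fP] n : exists x, x < a /\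
      forall y, fill (D n) a y -> (\bigcap_n D n) y -> Ecf lam y -> y <= x.
    apply: contrapT => nx; apply: nn; exists n => x xa; apply: contrapT => ny.
    apply: nx; exists x; split=> // y Fy Dy Ey; rewrite leNgt; apply/negP => xy.
    by apply: ny; exists y.
  apply: (cf_small wo (SE _ Sa) (A := range f)); last first.
    apply: small_image; apply: small_countable => //; exact: card_lexx.
  split=> [_ [n _ <-]|x xa]; first by case: (fP n).
  have [y [[Dy Ey] xy ya]] := lima _ xa.
  have [z [Dz Ez yz za [N NP]]] := fill_reach Dy Ey ya.
  exists (f N); first by exists N.
  apply: le_trans (ltW xy) (le_trans yz _); apply: (proj2 (fP N)) => //.
  exact: NP.
have cofF : cofinal_in a (fill (D n) a).
  split=> [x []//|x /nP[y [Fy _ _ /ltW xy]]]; by exists y.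
exists n, a; split=> //; rewrite /fill_sequence; case: asboolP => // _.
apply/supremumsP => [x [[[[] //]]]|x /nP[y [Fy Dy Ey xy]]].
exists y => //; split=> //; split; last exact: Dy.
by apply: fill_nacc => //; case: (Dclub n).
Qed.

End Decreasing.

End Walks.

Theorem theorem3p20 (d : Order.disp_t) (K : orderType d) (lam : K)
    (hK : succ_cardinal lam)
    (hlam : regular_uncountable lam)
    (hsq : weak_square lam)
    (S : set K) (hSE : S `<=` Ecf lam) (hS : stationary S) :
  exists C : K -> set K,
    square_transversal lam C /\
    forall D : set K, club D ->
      exists delta : K,
        S delta /\ supremums (nacc (C delta) `&` D `&` Ecf lam) delta.
Proof.
have [C hC] := weak_square_sequence hK hlam hsq.
apply: contrapT => noC.
(* [E D] is a club refuting the transversal built from [D]; off clubs its value is arbitrary. *)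
have /choice[E EP] D : exists D', club D -> club D' /\ forall a, S a ->
    ~ supremums (nacc (fill_sequence lam C D a) `&` D' `&` Ecf lam) a.
  have [cD|] := pselect (club D); last by exists setT.
  apply: contrapT => nD'; apply: noC; exists (fill_sequence lam C D).
  split; first exact: fill_transversal.
  move=> D' cD'; apply: contrapT => na; apply: nD'; exists D' => _; split=> //.
  by move=> a Sa sa; apply: na; exists a.
pose D n := iter n (fun D => D `&` E D) setT.
have Dclub n : club (D n).
  elim: n => [|n IHn]; first exact: club_setT.
  by apply: (clubI hK hlam IHn); case: (EP _ IHn).
have [//|n [a [Sa]]] := fill_guess hK hlam hC Dclub _ hS hSE.
  by move=> n x [].
have [_ /(_ _ Sa)] := EP _ (Dclub n); apply: contra_not.
(* As [D n.+1] is contained in [E (D n)], the supremum found passes to the larger set, provided that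
   set stays below [a]; this contradicts the choice of [E (D n)]. *)
have sub : nacc (fill_sequence lam C (D n) a) `<=` below a.
  by move=> x [Fx _]; have [/(_ a)[[+ _] _] _ _] :=
    fill_transversal hK hlam hC (Dclub n); apply.
move=> /supremumsP h; apply/supremumsP => [x [[/sub]] //|x xa].
have [|y [[Fy [_ Ey]] cy] xy] := h _ x xa; first by move=> z [[/sub]].
by exists y.
Qed.
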